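(* Let $n\geq 2$ be an integer and let $P\colon\mathbb{C}^n\to\mathbb{R}$ be a non-constant, homogeneous, plurisubharmonic polynomial without pluriharmonic terms, and assume that $P$ is homogeneous of degree $2d_j$, $d_j\in\mathbb{Z}_{>0}$, in $z_j,\overline{z_j}$ for $j=1,\dots,n$. Write $d:=\gcd(d_1,\dots,d_n)\in\mathbb{Z}_{\geq 1}$. Then there exists a homogeneous, subharmonic polynomial $s\colon\mathbb{C}\to\mathbb{R}$ without harmonic terms, such that $$P(z_1,\dots,z_n)=s\left(z_1^{d_1/d}\cdots z_n^{d_n/d}\right)$$ for all $(z_1,\dots,z_n)\in\mathbb{C}^n$.
   Context: A polynomial $\mathbb{C}^n\to\mathbb{R}$ means a real-valued polynomial in the coordinates and their complex conjugates, written $P(z)=\sum a_{\alpha,\beta}z^\alpha\overline{z}^\beta$ with multi-indices $\alpha,\beta\in(\mathbb{Z}_{\geq 0})^n$; homogeneous means $\mathbb{R}$-homogeneous (all terms have the same total degree $|\alpha|+|\beta|$). ''Without pluriharmonic terms'' (for $n=1$: ''without harmonic terms'') means that no purely holomorphic or purely anti-holomorphic terms appear, i.e. $a_{\alpha,\beta}\neq 0$ implies $|\alpha|>0$ and $|\beta|>0$. $P$ is homogeneous of degree $2d_j$ in $z_j,\overline{z_j}$ if $\alpha_j+\beta_j=2d_j$ for every $(\alpha,\beta)$ with $a_{\alpha,\beta}\neq 0$. *)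

(* Defs.v *)
From HB Require Import structures.
From mathcomp Require Import all_boot all_order all_algebra.
From mathcomp Require Import complex.
From mathcomp Require Import all_classical all_reals all_analysis.
(* Notations left out: they are incompatible with those of mathcomp-analysis. *)
From mathcomp Require Import -(notations) mpoly.
Set Implicit Arguments.
Unset Strict Implicit.
Unset Printing Implicit Defensive.
Import Order.TTheory GRing.Theory Num.Theory.
Import numFieldNormedType.Exports.
Local Open Scope classical_set_scope.
Local Open Scope ring_scope.

(* [R[i]^o] is the field [R[i]] equipped with its usual (norm) topology;
   [R[i]] itself carries no topology in the libraries. *)
Notation CC R := (R[i]^o) (only parsing).

(* A polynomial in z_1, .., z_n and their conjugates is a polynomial in n + n
   indeterminates: the first n stand for the z_j, the last n for the conjugates.
   The monomial z^alpha * conj(z)^beta is thus the multinomial m with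
   [alpha_j = hol_exp m j] and [beta_j = anti_exp m j]. *)
Notation zzpoly n R := (mpoly (n + n) R[i]) (only parsing).

Definition hol_exp n (m : multinom (n + n)) (j : 'I_n) : nat :=
  fun_of_multinom m (lshift n j).

Definition anti_exp n (m : multinom (n + n)) (j : 'I_n) : nat :=
  fun_of_multinom m (rshift n j).

Definition zzeval (R : realType) n (p : zzpoly n R) (z : 'rV[CC R]_n) : R[i] :=
  meval
    (fun k : 'I_(n + n) =>
       match fintype.split k with
       | inl j => z 0 j
       | inr j => Num.conj (z 0 j : R[i])
       end) p.

(* [P] is real-valued and is the polynomial with coefficients those of [p]; such
   a [p] is unique, so conditions on the coefficients of [P] are stated on [p]. *)
Definition is_real_poly (R : realType) n (P : 'rV[CC R]_n -> R)
    (p : zzpoly n R) : Prop :=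
  forall z, (P z)%:C%C = zzeval p z.

Definition homogeneous (R : realType) n (p : zzpoly n R) : Prop :=
  exists k : nat, p \is ishomog1 k mdeg.

Definition homogeneous_in (R : realType) n (p : zzpoly n R) (j : 'I_n)
    (k : nat) : Prop :=
  forall m, m \in msupp p -> (hol_exp m j + anti_exp m j)%N = k.

Definition no_pluriharmonic_terms (R : realType) n (p : zzpoly n R) : Prop :=
  forall m, m \in msupp p ->
    (0 < \sum_(j < n) hol_exp m j)%N /\ (0 < \sum_(j < n) anti_exp m j)%N.

Definition upper_semicontinuous (R : realType) (X : topologicalType)
    (u : X -> R) : Prop :=
  lower_semicontinuous (fun x => (- u x)%:E).

(* Sub-mean value inequality over all circles. The integral is taken in the
   extended reals: an upper semicontinuous function is bounded above on the
   circle, but its integral may be -oo. *)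
Definition subharmonic (R : realType) (u : CC R -> R) : Prop :=
  upper_semicontinuous u /\
  forall (a : CC R) (r : R), 0 < r ->
    ((u a)%:E <= ((2 * pi)^-1)%:E *
      \int[lebesgue_measure]_(t in `[0%R, (2 * pi)%R])
        (u (a + r%:C%C * (cos t +i* sin t)%C))%:E)%E.

Definition plurisubharmonic (R : realType) n (u : 'rV[CC R]_n -> R) : Prop :=
  upper_semicontinuous u /\
  forall a b : 'rV[CC R]_n, subharmonic (fun l : CC R => u (a + l *: b)).

(* Main.v *)
Require Import Defs.
From mathcomp Require Import all_boot all_order all_algebra.
From mathcomp Require Import complex.
From mathcomp Require Import all_classical all_reals all_analysis.
From mathcomp Require Import cyclic separable cyclotomic polyrcf ring lra zify.
From mathcomp Require Import -(notations) mpoly.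
Set Implicit Arguments.
Unset Strict Implicit.
Unset Printing Implicit Defensive.
Import Order.TTheory GRing.Theory Num.Theory.
Import numFieldNormedType.Exports.
Local Open Scope classical_set_scope.
Local Open Scope ring_scope.

(** Write [P z = sum_m c_m z^alpha conj(z)^beta], the sum being over the
    monomials [m = (alpha, beta)] of [p], so that [alpha_j + beta_j = 2 d_j].

    The exponents are parallel to [d] ([hol_exp_parallel]).  Plurisubharmonicity
    on the complex lines [l |-> a + l (v_j a_j)_j] makes the Levi form
    nonnegative ([psh_lev_ge0]):
      [sum_m c_m (alpha . v) (beta . v) a^alpha conj(a)^beta >= 0]
    for all [a] and all real [v].  If [v . d = 0], then
    [beta . v = - alpha . v].  Over the torus [|a_j| = 1], only the monomial with
    [alpha = beta = d] has a nonzero mean, and its coefficient contains the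
    factor [(d . v)^2 = 0].  The mean of the Levi form is thus zero; a
    nonnegative function of mean zero vanishes, and so do its Fourier
    coefficients [- c_m (alpha . v)^2].
    Hence [alpha . v = 0] whenever [c_m <> 0].  Taking
    [v = d_j e_i - d_i e_j] gives [alpha_i d_j = alpha_j d_i].  The torus is
    replaced here by the finite set of points [a_j = w^(k K^j)], with [w] a root
    of unity of large order and [K] large enough for [sum_j alpha_j K^j] to
    determine [alpha]; this reduces the argument to Fourier analysis on a cyclic
    group ([fourier_ge0_eq0]).

    With [g = gcd(d_1, .., d_n)] it follows that [alpha = k d / g] and
    [beta = (2 g - k) d / g] for an integer [k] ([parallel_gcd]), so that
    [P z = s (prod_j z_j^(d_j / g))] with
    [s z = sum_m c_m z^k conj(z)^(2 g - k)].  As [z |-> prod_j z_j^(d_j / g)] is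
    onto, [s] is real-valued.

    Subharmonicity of [s] is transferred through its Laplacian.  Along a line
    where only the coordinate [z_i] varies, [P] is [s] composed with a power
    map, so the Laplacian of [s] is nonnegative away from [0]
    ([lap_s_ge0_neq0]), and then at [0] by homogeneity ([lap_s_ge0]).  The
    equivalence of the sub-mean value inequality with nonnegativity of the
    Laplacian is elementary for polynomials in [z] and [conj z]: the mean of [u]
    over the circle of radius [r] about a point is a polynomial [q] in
    [t = r^2] ([has_mean_beval]), whose linear coefficient is the value of
    [d^2 u / dz dconj(z)] at the centre and is nonnegative if [q t >= q 0] for
    all [t > 0] ([coef1_ge0]).  The mean of this derivative is [(t q')']
    ([radial_lap]); if it is nonnegative then [q] is nondecreasing
    ([radial_le]). *)

(** * Means over circles *)

(** The point of the unit circle of argument [t]. *)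
Definition circ (R : realType) (t : R) : R[i] := (cos t +i* sin t)%C.

Lemma circX (R : realType) (t : R) k : circ t ^+ k = circ (k%:R * t).
Proof.
elim: k => [|k IH]; first by rewrite mul0r /circ cos0 sin0.
rewrite exprS IH -natr1 mulrDl mul1r /circ cosD sinD.
apply/eqP; rewrite eq_complex /=; apply/andP; split; apply/eqP; ring.
Qed.

Lemma circ_mulJ (R : realType) (t : R) k l :
  circ t ^+ k * Num.conj (circ t) ^+ l = circ ((k%:R - l%:R) * t).
Proof.
rewrite -rmorphXn !circX /circ mulrBl cosB sinB.
apply/eqP; rewrite eq_complex /=; apply/andP; split; apply/eqP; ring.
Qed.

(** [c] is the mean of [g] over the interval from [0] to [2 * pi], as witnessed
    by a primitive of the continuous function [g].  In this form, sums of
    functions need no integrability side conditions. *)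
Definition has_mean (R : realType) (g : R -> R) (c : R) : Prop :=
  exists F : R -> R, [/\ forall t : R, is_derive t (1:R) F (g t),
    continuous g & F (2 * pi) - F 0 = 2 * pi * c].

Lemma has_mean_integral (R : realType) (g : R -> R) c : has_mean g c ->
  (\int[lebesgue_measure]_(t in `[0%R, (2 * pi)%R]) (g t)%:E = (2 * pi * c)%:E)%E.
Proof.
move=> [F [dF cg F2]].
have cF : continuous F.
  by move=> t; apply/differentiable_continuous/derivable1_diffP; case: (dF t).
rewrite (@continuous_FTC2 _ g F) -?EFinB ?F2 //.
- by rewrite mulr_gt0 ?pi_gt0.
- exact: continuous_subspaceT.
- split=> [x _||]; first by case: (dF x).
    by apply: cvg_at_right_filter; exact: cF.
  by apply: cvg_at_left_filter; exact: cF.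
- by move=> x _; rewrite derive1E; case: (dF x).
Qed.

Lemma has_mean0 (R : realType) : has_mean (fun _ : R => 0) 0.
Proof.
exists (fun _ => 0); split; [by move=> t; exact: is_derive_cst| |by rewrite mulr0 subrr].
exact: cst_continuous.
Qed.

Lemma has_meanD (R : realType) (f g : R -> R) a b :
  has_mean f a -> has_mean g b -> has_mean (fun t => f t + g t) (a + b).
Proof.
move=> [F [dF cf Fa]] [G [dG cg Gb]]; exists (F + G); split.
- by move=> t; exact: is_deriveD.
- by move=> t; apply: continuousD; [exact: cf|exact: cg].
- by rewrite [RHS]mulrDr -Fa -Gb !fctE; ring.
Qed.

Lemma has_mean_sum (R : realType) (I : Type) (s : seq I) (f : I -> R -> R) a :
  (forall i, has_mean (f i) (a i)) ->
  has_mean (fun t => \sum_(i <- s) f i t) (\sum_(i <- s) a i).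
Proof.
move=> fa; elim: s => [|i s IH].
  rewrite big_nil; under eq_fun do rewrite big_nil; exact: has_mean0.
rewrite big_cons; under eq_fun do rewrite big_cons; exact: has_meanD.
Qed.

(** Orthogonality of the characters of the circle. *)
Lemma has_mean_circ (R : realType) (c : R[i]) k l :
  has_mean (fun t => complex.Re (c * (circ t ^+ k * Num.conj (circ t) ^+ l)))
    (if k == l then complex.Re c else 0).
Proof.
under eq_fun do rewrite circ_mulJ.
have [->|kl] := eqVneq.
  exists (fun t => complex.Re c * t); split.
  - move=> t; rewrite subrr mul0r /circ cos0 sin0; case: c => a b /=.
    apply: is_derive_eq; rewrite /GRing.scale /=; ring.
  - move=> t; under eq_fun do rewrite subrr mul0r; exact: cst_continuous.
  - by ring.
set n : R := k%:R - l%:R.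
have n0 : n != 0 by rewrite subr_eq0 eqr_nat.
have cn : cos (n * (2 * pi)) = 1 :> R /\ sin (n * (2 * pi)) = 0 :> R.
  have E m : cos (m%:R * (2 * pi)) = 1 :> R /\ sin (m%:R * (2 * pi)) = 0 :> R.
    have <- : (0 + (pi *+ 2) *+ m)%R = m%:R * (2 * pi) :> R.
      by rewrite add0r -[LHS]mulr_natl -[pi *+ 2]mulr_natl.
    by rewrite (periodicn (@cosD2pi R)) (periodicn (@sinD2pi R)) cos0 sin0.
  have [ck sk] := E k; have [cl sl] := E l.
  by rewrite /n mulrBl cosB sinB ck sk cl sl; split; ring.
exists (fun t => complex.Re c * (n^-1 * sin (n * t)) +
  complex.Im c * (n^-1 * cos (n * t))); split.
- move=> t; case: c => a b /=.
  have dn : is_derive t (1:R) (fun t => n * t) n.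
    by apply: is_derive_eq; rewrite /GRing.scale /=; ring.
  have ds : is_derive t (1:R) (fun t => sin (n * t)) (cos (n * t) * n).
    exact: (@is_derive1_comp R sin (fun t => n * t)).
  have dc : is_derive t (1:R) (fun t => cos (n * t)) (- sin (n * t) * n).
    exact: (@is_derive1_comp R cos (fun t => n * t)).
  apply: is_derive_eq; rewrite /GRing.scale /=.
  by field.
- move=> t; case: c => a b /=.
  have cnt : {for t, continuous (fun t => n * t)} by apply: mulrl_continuous.
  apply: cvgB; (apply: cvgM; first exact: cvg_cst).
    by apply: (@continuous_comp _ _ _ (fun t => n * t) cos) => //; exact: continuous_cos.
  by apply: (@continuous_comp _ _ _ (fun t => n * t) sin) => //; exact: continuous_sin.
- have [-> ->] := cn; rewrite !mulr0 sin0 cos0; ring.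
Qed.

(** * Polynomials in a complex variable and its conjugate *)

(** A sequence of pairs [(F, G)] of polynomials stands for the function
    [sum F(z) G(conj z)]. *)
Notation zpairs R := (seq ({poly R[i]} * {poly R[i]})) (only parsing).

(** The value at [z] of the function that [s] stands for. *)
Definition beval (R : realType) (s : zpairs R) (z : R[i]) : R[i] :=
  \sum_(x <- s) x.1.[z] * x.2.[Num.conj z].

(** The polynomial in [r ^+ 2] that gives the mean of the real part of [beval s]
    over the circle of radius [r] about [0]. *)
Definition radial (R : realType) (s : zpairs R) : {poly R} :=
  \sum_(x <- s) \poly_(k < size x.1) complex.Re (x.1`_k * x.2`_k).

(** The derivative with respect to [z] and to [conj z], that is, a quarter of
    the Laplacian. *)
Definition lap (R : realType) (s : zpairs R) :=
  [seq (x.1^`(), x.2^`()) | x <- s].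

(** The translate [z |-> beval s (a + z)]. *)
Definition shift (R : realType) (a : R[i]) (s : zpairs R) :=
  [seq (x.1 \Po ('X + a%:P), x.2 \Po ('X + (Num.conj a)%:P)) | x <- s].

Section Bivariate.
Variable R : realType.
Implicit Types (s : zpairs R) (a z : R[i]) (q : {poly R}).

Lemma ReD z a : complex.Re (z + a) = complex.Re z + complex.Re a.
Proof. by case: z; case: a. Qed.

Lemma Re_sum (I : Type) (r : seq I) (f : I -> R[i]) :
  complex.Re (\sum_(i <- r) f i) = \sum_(i <- r) complex.Re (f i).
Proof. by apply: (big_morph (@complex.Re R)) => // x y; exact: ReD. Qed.

Lemma ReMl (c : R) z : complex.Re (c%:C%C * z) = c * complex.Re z.
Proof. by case: z => x y /=; rewrite mul0r subr0. Qed.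

Lemma conj_real (c : R) : Num.conj (c%:C%C : R[i]) = c%:C%C.
Proof. exact: conjc_real. Qed.

Lemma conj_real_mul (c : R) z : Num.conj (c%:C%C * z) = c%:C%C * Num.conj z.
Proof. by rewrite rmorphM /= conj_real. Qed.

Lemma coef_radial s k :
  (radial s)`_k = \sum_(x <- s) complex.Re (x.1`_k * x.2`_k).
Proof.
rewrite coef_sum; apply: eq_bigr => x _; rewrite coef_poly.
by case: ltnP => // h; rewrite nth_default // mul0r.
Qed.

(** Only the products of the coefficients of [z^k] in [F] and of [conj(z)^k] in
    [G], with the same [k], contribute to the mean. *)
Lemma has_mean_beval s (r : R) :
  has_mean (fun t => complex.Re (beval s (r%:C%C * circ t))) (radial s).[r ^+ 2].
Proof.
rewrite /radial horner_sum.
under eq_fun do rewrite /beval Re_sum.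
apply: has_mean_sum => -[F G] /=.
have -> : (\poly_(k < size F) complex.Re (F`_k * G`_k)).[r ^+ 2] =
  \sum_(i < size F) \sum_(j < size G)
    (if i == j :> nat then complex.Re ((r ^+ (i + j))%:C%C * (F`_i * G`_j)) else 0).
  rewrite horner_poly; apply: eq_bigr => i _.
  have [iG|iG] := ltnP i (size G); last first.
    rewrite [G`_i]nth_default // mulr0 mul0r big1 // => j _.
    by case: eqP => // ij; move: iG; rewrite ij leqNgt ltn_ord.
  rewrite (bigD1 (Ordinal iG)) //= eqxx big1 ?addr0 => [|j /eqP ji].
    by rewrite ReMl addnn -mul2n exprM mulrC.
  by case: eqP => // ij; case: ji; apply/val_inj.
have term (c d u v : R[i]) i j : c * (r%:C%C * u) ^+ i * (d * (r%:C%C * v) ^+ j) =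
    ((r ^+ (i + j))%:C%C * (c * d)) * (u ^+ i * v ^+ j).
  by rewrite !exprMn exprD rmorphM !rmorphXn /=; ring.
under eq_fun => t.
  rewrite conj_real_mul !horner_coef mulr_suml Re_sum.
  under eq_bigr => i _.
    rewrite mulr_sumr Re_sum.
    under eq_bigr => j _ do rewrite term.
    over.
  over.
apply: has_mean_sum => i; apply: has_mean_sum => j; exact: has_mean_circ.
Qed.

Lemma beval0 s : complex.Re (beval s 0) = (radial s).[0].
Proof.
rewrite horner_coef0 coef_radial /beval Re_sum; apply: eq_bigr => x _.
by rewrite rmorph0 !horner_coef0.
Qed.

Lemma beval_shift a s z : beval (shift a s) z = beval s (a + z).
Proof.
rewrite /beval big_map; apply: eq_bigr => x _ /=.
by rewrite !horner_comp !hornerE rmorphD addrC [Num.conj z + _]addrC.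
Qed.

Lemma lap_shift a s : lap (shift a s) = shift a (lap s).
Proof.
rewrite /lap /shift -!map_comp; apply: eq_map => x /=.
by rewrite !deriv_comp !derivD !derivX !derivC !addr0 !mulr1.
Qed.

Lemma radial_lap s : radial (lap s) = ('X * (radial s)^`())^`().
Proof.
apply/polyP => k; rewrite coef_deriv coefXM coef_deriv !coef_radial /=.
rewrite big_map -!sumrMnl; apply: eq_bigr => x _ /=.
by rewrite !coef_deriv mulrnAl mulrnAr !raddfMn.
Qed.

(** The linear coefficient of [q] is the right derivative of [q] at [0]. *)
Lemma coef1_ge0 q : (forall t : R, 0 < t -> q.[0] <= q.[t]) -> 0 <= q`_1.
Proof.
move=> h.
have [p1 E] : exists p1, q = p1 * 'X + (q.[0])%:P.
  exists (drop_poly 1 q); rewrite -[LHS](poly_take_drop 1) addrC expr1.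
  congr (_ + _); apply/polyP => -[|k]; by rewrite coef_take_poly coefC //= horner_coef0.
have -> : q`_1 = p1.[0].
  by rewrite E coefD coefMX coefC /= addr0 horner_coef0.
rewrite leNgt; apply/negP => p0.
have [d d0 hd] : exists2 d, 0 < d &
    forall y, `|y - 0| < d -> `|p1.[y] - p1.[0]| < - p1.[0].
  by have [d ? ?] := @poly_cont _ 0 p1 (- p1.[0]) ltac:(by rewrite oppr_gt0); exists d.
have d20 : 0 < d / 2 by rewrite divr_gt0.
have := h _ d20; rewrite {2}E hornerD hornerMX hornerC lerDr pmulr_lge0 //.
rewrite leNgt => /negP; apply.
have d2d : `|d / 2 - 0| < d by rewrite subr0 gtr0_norm // ltr_pdivrMr // ltr_pMr // ltr1n.
move: (hd _ d2d); rewrite ltr_norml => /andP[_].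
by rewrite ltrBlDr addNr.
Qed.

(** The operator [q |-> (X q')'] is a quarter of the Laplacian of radial
    functions in the variable [t = r^2]; two integrations show that [q] is
    nondecreasing. *)
Lemma radial_le q : (forall t : R, 0 < t -> 0 <= ('X * q^`())^`().[t]) ->
  forall t : R, 0 < t -> q.[0] <= q.[t].
Proof.
move=> h t t0.
have q'0 x : 0 < x -> 0 <= q^`().[x].
  move=> x0; rewrite -(pmulr_rge0 _ x0).
  have := @ler_hornerW R 0 x ('X * q^`()) _ 0 x.
  rewrite !hornerE; apply; rewrite ?in_itv /= ?lexx ?ltW //.
  by move=> y; rewrite in_itv /= => /andP[y0 _]; exact: h.
apply: (@ler_hornerW R 0 t q); rewrite ?in_itv /= ?lexx ?ltW //.
by move=> y; rewrite in_itv /= => /andP[y0 _]; exact: q'0.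
Qed.

(** The sub-mean value inequality about [0] makes the Laplacian nonnegative
    at [0]. *)
Lemma radial1_ge0 s :
  (forall r : R, 0 < r -> ((complex.Re (beval s 0))%:E <= ((2 * pi)^-1)%:E *
      \int[lebesgue_measure]_(t in `[0%R, (2 * pi)%R])
        (complex.Re (beval s (r%:C%C * circ t)))%:E)%E) ->
  0 <= (radial s)`_1.
Proof.
move=> h; apply: coef1_ge0 => t t0.
have := h (Num.sqrt t); rewrite sqrtr_gt0 => /(_ t0).
rewrite (has_mean_integral (has_mean_beval _ _)).
rewrite (sqr_sqrtr (ltW t0)) beval0.
by rewrite -EFinM lee_fin mulKf // mulf_neq0 ?gt_eqF ?pi_gt0.
Qed.

Lemma conj_continuous : continuous (Num.conj : R[i]^o -> R[i]^o).
Proof.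
move=> x; have FF : Filter (nbhs (x : R[i]^o)) by exact: nbhs_filter.
apply/(@cvgrPdist_lt _ (R[i]^o) _ (nbhs (x : R[i]^o)) FF) => e e0.
have : \forall y \near (x : R[i]^o), `|x - y| < e.
  by apply/nbhs_ballP; exists e.
by apply: filterS => y; rewrite -rmorphB norm_conjC.
Qed.

Lemma horner_continuous (p : {poly R[i]}) : continuous (horner p : R[i]^o -> R[i]^o).
Proof.
move=> x; have FF : Filter (nbhs (x : R[i]^o)) by exact: nbhs_filter.
elim/poly_ind: p => [|p c IH].
  rewrite (_ : horner 0 = fun=> 0) => [|]; first exact: cst_continuous.
  by apply/funext => y; rewrite horner0.
rewrite (_ : horner _ = (fun y => p.[y] * y) + (fun=> c)); last first.
  by apply/funext => y; rewrite hornerD hornerMX hornerC.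
apply: (@cvgD _ (R[i]^o) _ (nbhs (x : R[i]^o)) FF (fun y => p.[y] * y) (fun=> c)).
  exact: (@cvgM _ _ (nbhs (x : R[i]^o)) FF (horner p) id p.[x] x IH cvg_id).
exact: (@cst_continuous _ (R[i]^o)).
Qed.

Lemma beval_continuous s : continuous (beval s : R[i]^o -> R[i]^o).
Proof.
move=> x; have FF : Filter (nbhs (x : R[i]^o)) by exact: nbhs_filter.
elim: s => [|[F G] s IH].
  rewrite (_ : beval [::] = fun=> 0) => [|]; first exact: cst_continuous.
  by apply/funext => y; rewrite /beval big_nil.
rewrite (_ : beval _ = (fun y => F.[y] * G.[Num.conj y]) + beval s); last first.
  by apply/funext => y; rewrite /beval big_cons.
apply: (@cvgD _ (R[i]^o) _ (nbhs (x : R[i]^o)) FF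
  (fun y => F.[y] * G.[Num.conj y]) (beval s)); last exact: IH.
apply: (@cvgM _ _ (nbhs (x : R[i]^o)) FF (horner F) (fun y => G.[Num.conj y])).
  exact: horner_continuous.
apply: (@continuous_comp _ _ _ (Num.conj : R[i]^o -> R[i]^o) (horner G : R[i]^o -> R[i]^o)).
  exact: conj_continuous.
exact: horner_continuous.
Qed.

Lemma usc_beval s : upper_semicontinuous (fun z : R[i]^o => complex.Re (beval s z)).
Proof.
move=> x a; rewrite lte_fin => ax.
set e := - complex.Re (beval s x) - a.
have e0 : 0 < e by rewrite subr_gt0.
exists [set y | `|beval s x - beval s y| < e%:C%C].
  move: (@beval_continuous s x) => /cvgrPdist_lt/(_ e%:C%C); apply.
  by rewrite ltcR.
move=> y /= h; rewrite lte_fin.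
have := le_lt_trans (normc_ge_Re _) h; rewrite ltcR ltr_norml => /andP[+ _].
by rewrite /e; case: (beval s x) => ? ?; case: (beval s y) => ? ? /=; lra.
Qed.

(** A polynomial with nonnegative Laplacian is subharmonic: after translation to
    the centre of the circle, the mean is nondecreasing in the radius. *)
Lemma subharmonic_beval s :
  (forall z, 0 <= complex.Re (beval (lap s) z)) ->
  subharmonic (fun z : R[i]^o => complex.Re (beval s z)).
Proof.
move=> h; split; first exact: usc_beval.
move=> a r r0; rewrite -[a in X in (X <= _)%E]addr0 -beval_shift beval0.
under eq_integral do rewrite -beval_shift.
rewrite (has_mean_integral (has_mean_beval _ _)) -EFinM lee_fin.
rewrite mulKf ?mulf_neq0 ?gt_eqF ?pi_gt0 //.
apply: radial_le; last by rewrite exprn_gt0.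
move=> t t0; rewrite -radial_lap lap_shift -[t](sqr_sqrtr (ltW t0)).
have := has_mean_integral (has_mean_beval (shift a (lap s)) (Num.sqrt t)).
have : (0 <= \int[lebesgue_measure]_(t0 in `[0%R, (2 * pi)%R])
   (complex.Re (beval (shift a (lap s)) ((Num.sqrt t)%:C%C * circ t0)))%:E)%E.
  by apply: integral_ge0 => u _; rewrite lee_fin beval_shift.
move=> + E; rewrite E lee_fin pmulr_rge0 // mulr_gt0 ?pi_gt0 //.
Qed.

End Bivariate.

(** * Fourier analysis on a finite cyclic group *)

Lemma prim_root_exists (C : numClosedFieldType) n :
  (0 < n)%N -> exists z : C, n.-primitive_root z.
Proof.
pose p : {poly C} := 'X^n - 1; have [r Dp] := closed_field_poly_normal p.
move=> n_gt0; rewrite (monicP _) ?monicXnsubC // scale1r in Dp.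
have rn1 : all n.-unity_root r by apply/allP=> z; rewrite -root_prod_XsubC -Dp.
have sz_r : (n < (size r).+1)%N.
  by rewrite -(size_prod_XsubC r id) -Dp size_XnsubC.
have [|z] := hasP (has_prim_root n_gt0 rn1 _ sz_r); last by exists z.
by rewrite -separable_prod_XsubC -Dp separable_Xn_sub_1 // pnatr_eq0 -lt0n.
Qed.

Lemma sum_prim_root (F : fieldType) N (w : F) x y : N.-primitive_root w ->
  (x < N)%N -> (y < N)%N ->
  \sum_(k < N) (w ^+ x / w ^+ y) ^+ k = if x == y then N%:R else 0.
Proof.
move=> pw xN yN; have N0 := prim_order_gt0 pw.
have w0 k : w ^+ k != 0.
  by rewrite expf_neq0 // (prim_root_eq0 pw) -lt0n.
have [->|xy] := eqVneq.
  rewrite divff //; under eq_bigr do rewrite expr1n.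
  by rewrite sumr_const card_ord.
set u := _ / _.
have u1 : u - 1 != 0.
  rewrite subr_eq0; apply: contra xy => /eqP E.
  have : w ^+ x == w ^+ y by rewrite -[_ ^+ x](divfK (w0 y)) -/u E mul1r.
  by rewrite (eq_prim_root_expr pw) /= !modn_small.
apply/(mulfI u1); rewrite mulr0 -subrX1 expr_div_n -!exprM mulnC exprM.
by rewrite (mulnC y) exprM (prim_expr_order pw) !expr1n divr1 subrr.
Qed.

(** A nonnegative function on a cyclic group whose mean, the coefficient of
    index [y], vanishes is zero, and so are its Fourier coefficients. *)
Lemma fourier_ge0_eq0 (C : numFieldType) N (w : C) (T : eqType) (s : seq T)
    (g : T -> C) (x : T -> nat) y :
  N.-primitive_root w -> uniq s -> (forall m, m \in s -> (x m < N)%N) ->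
  (y < N)%N -> {in s &, injective x} ->
  (forall m, m \in s -> x m = y -> g m = 0) ->
  (forall k, 0 <= \sum_(m <- s) g m * (w ^+ x m / w ^+ y) ^+ k) ->
  forall m, m \in s -> g m = 0.
Proof.
move=> pw us xN yN xi gy f0 m ms; have N0 := prim_order_gt0 pw.
have w0 k : w ^+ k != 0.
  by rewrite expf_neq0 // (prim_root_eq0 pw) -lt0n.
have sum0 : \sum_(k < N) \sum_(m <- s) g m * (w ^+ x m / w ^+ y) ^+ k = 0.
  rewrite exchange_big /= big1_seq // => m' /andP[_ m's].
  rewrite -mulr_sumr sum_prim_root //; last exact: xN.
  by case: eqP => [/(gy _ m's) ->|_]; rewrite ?mulr0 ?mul0r.
have f_eq0 (k : 'I_N) : \sum_(m <- s) g m * (w ^+ x m / w ^+ y) ^+ k = 0.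
  by move/psumr_eq0P: sum0 => ->.
(* The coefficient of index [x m] is recovered by Fourier inversion. *)
have : \sum_(k < N) (w ^+ y / w ^+ x m) ^+ k *
   \sum_(m <- s) g m * (w ^+ x m / w ^+ y) ^+ k = 0.
  by rewrite big1 // => k _; rewrite f_eq0 mulr0.
have E (k : nat) m' : (w ^+ y / w ^+ x m) ^+ k * (g m' * (w ^+ x m' / w ^+ y) ^+ k) =
    g m' * (w ^+ x m' / w ^+ x m) ^+ k.
  by rewrite mulrCA -exprMn; congr (_ * _ ^+ k); rewrite mulrC mulrA mulfVK ?w0.
under eq_bigr do (rewrite mulr_sumr; under eq_bigr do rewrite E).
rewrite exchange_big /= (bigD1_seq m) //= [X in _ + X]big1_seq ?addr0.
  rewrite -mulr_sumr sum_prim_root ?xN // eqxx => /eqP.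
  by rewrite mulf_eq0 pnatr_eq0 -[N == _]negbK -lt0n N0 orbF => /eqP.
move=> m' /andP[m'm m's]; rewrite -mulr_sumr sum_prim_root ?xN //.
by case: eqP => [/(xi _ _ m's ms) E'|]; [rewrite E' eqxx in m'm|rewrite mulr0].
Qed.

(** Uniqueness of expansions in base [K]. *)
Lemma expansion_inj n K (a b : 'I_n -> nat) :
  (forall i, (a i < K)%N) -> (forall i, (b i < K)%N) ->
  (\sum_i a i * K ^ i = \sum_i b i * K ^ i)%N -> a =1 b.
Proof.
elim: n a b => [|n IH] a b aK bK; first by move=> _ [].
have K0 : (0 < K)%N by rewrite (leq_ltn_trans _ (aK ord0)).
have E (c : 'I_n.+1 -> nat) : (\sum_i c i * K ^ i =
    (\sum_i c (lift ord0 i) * K ^ i) * K + c ord0)%N.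
  rewrite big_ord_recl /= expn0 muln1 addnC big_distrl /=; congr (_ + _)%N.
  by apply: eq_bigr => i _; rewrite /bump /= add1n expnSr mulnA.
rewrite !E => H.
have H0 : a ord0 = b ord0.
  by have := congr1 (modn^~ K) H; rewrite !modnMDl !modn_small.
move: H; rewrite H0 => /addIn/eqP; rewrite eqn_pmul2r // => /eqP/IH H1 i.
by have [j ->|->] := unliftP ord0 i; [apply: H1|].
Qed.

(** * The Levi form along complex lines *)

(** The coefficient of [z conj(z)] in [beval s]. *)
Definition lev (R : realType) (s : zpairs R) : R[i] :=
  \sum_(x <- s) x.1`_1 * x.2`_1.

(** The restriction of [p] to the complex line [l |-> a + l b]. *)
Definition line (R : realType) n (p : zzpoly n R) (a b : 'I_n -> R[i]) : zpairs R :=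
  [seq (mcoeff m p *: \prod_(j < n) ((a j)%:P + b j *: 'X) ^+ hol_exp m j,
        \prod_(j < n) ((Num.conj (a j))%:P + Num.conj (b j) *: 'X) ^+ anti_exp m j)
  | m <- msupp p].

Section Line.
Variable R : realType.
Implicit Types (s : zpairs R).

Lemma zzevalE n (p : zzpoly n R) (z : 'rV[CC R]_n) :
  zzeval p z = \sum_(m <- msupp p) mcoeff m p *
    (\prod_(j < n) z 0 j ^+ hol_exp m j *
     \prod_(j < n) Num.conj (z 0 j : R[i]) ^+ anti_exp m j).
Proof.
rewrite /zzeval mevalE; apply: eq_bigr => m _; congr (_ * _).
rewrite big_split_ord /=; congr (_ * _); apply: eq_bigr => j _.
  by rewrite -[lshift n j]/(unsplit (inl j)) unsplitK.
by rewrite -[rshift n j]/(unsplit (inr j)) unsplitK.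
Qed.

Lemma beval_line n (p : zzpoly n R) (a b : 'rV[CC R]_n) (l : CC R) :
  beval (line p (a 0) (b 0)) l = zzeval p (a + l *: b).
Proof.
rewrite zzevalE /beval big_map; apply: eq_bigr => m _ /=.
rewrite hornerZ -mulrA !horner_prod; congr (_ * (_ * _)); apply: eq_bigr => j _.
  by rewrite !hornerE !mxE mulrC.
by rewrite !hornerE !mxE rmorphD rmorphM /= mulrC.
Qed.

(** The conclusion is in the order of the complex numbers: it also says that
    [lev s] is real. *)
Lemma lev_ge0 s :
  (forall z, complex.Im (beval s z) = 0) ->
  (forall r : R, 0 < r -> ((complex.Re (beval s 0))%:E <= ((2 * pi)^-1)%:E *
      \int[lebesgue_measure]_(t in `[0%R, (2 * pi)%R])
        (complex.Re (beval s (r%:C%C * circ t)))%:E)%E) ->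
  0 <= lev s.
Proof.
move=> hr hs.
have levE (c : R[i]) : complex.Re (c * lev s) =
    (radial [seq (c *: x.1, x.2) | x <- s])`_1.
  rewrite coef_radial big_map /lev mulr_sumr Re_sum; apply: eq_bigr => x _ /=.
  by rewrite coefZ mulrA.
have bevalE (c : R[i]) z : beval [seq (c *: x.1, x.2) | x <- s] z = c * beval s z.
  rewrite /beval big_map mulr_sumr; apply: eq_bigr => x _ /=.
  by rewrite hornerZ mulrA.
(* For purely imaginary [c], the real part of [c * beval s] is zero, hence
   subharmonic; [c = i] and [c = - i] show that [lev s] is real. *)
have Im0 (c : R[i]) : complex.Re c = 0 -> 0 <= complex.Re (c * lev s).
  move=> c0; rewrite levE; apply: radial1_ge0 => r r0.
  have E z : complex.Re (beval [seq (c *: x.1, x.2) | x <- s] z) = 0.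
    rewrite bevalE; move: (hr z) c0; case: c => c1 c2; case: (beval s z) => u v /=.
    by move=> -> ->; rewrite mul0r mulr0 subr0.
  rewrite E; under eq_integral do rewrite E.
  by rewrite integral_cst // mul0e mule0.
have := radial1_ge0 hs; rewrite coef_radial -Re_sum -/(lev s).
have := Im0 (Complex 0 1) erefl; have := Im0 (Complex 0 (-1)) erefl.
rewrite lecE; case: (lev s) => u v /=.
rewrite !mul0r mulN1r opprK add0r mul1r sub0r oppr_ge0 => v1 v2 ->.
by rewrite andbT; apply/eqP/le_anti; rewrite v1 v2.
Qed.

Lemma psh_lev_ge0 n (P : 'rV[CC R]_n -> R) (p : zzpoly n R) (a b : 'rV[CC R]_n) :
  is_real_poly P p -> plurisubharmonic P -> 0 <= lev (line p (a 0) (b 0)).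
Proof.
move=> hP [_ hpsh]; have := hpsh a b.
have -> : (fun l => P (a + l *: b)) =
    fun l => complex.Re (beval (line p (a 0) (b 0)) l).
  by apply/funext => l; rewrite beval_line -hP.
move=> [_ sm]; apply: lev_ge0 => [z|r r0]; first by rewrite beval_line -hP.
have := sm 0 r r0.
by under eq_integral do rewrite add0r.
Qed.

End Line.

(** * The exponents are parallel to d *)

Section Structure.
Variable R : realType.

Lemma coef01_prod (I : Type) (r : seq I) (f : I -> {poly R[i]}) (x c : I -> R[i]) :
  (forall i, (f i)`_0 = x i /\ (f i)`_1 = x i * c i) ->
  (\prod_(i <- r) f i)`_1 = \prod_(i <- r) x i * \sum_(i <- r) c i.
Proof.
move=> fx.
suff [] : (\prod_(i <- r) f i)`_0 = \prod_(i <- r) x i /\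
  (\prod_(i <- r) f i)`_1 = \prod_(i <- r) x i * \sum_(i <- r) c i by [].
elim: r => [|i r [IH0 IH1]]; first by rewrite !big_nil !coefC mulr0.
rewrite !big_cons; have [f0 f1] := fx i.
rewrite !coefM !big_ord_recl !big_ord0 /= subn0 IH0 IH1 f0 f1.
by rewrite addr0; split=> //; rewrite addr0; ring.
Qed.

Lemma coef1_exp_line n (a v : 'I_n -> R[i]) (e : 'I_n -> nat) :
  (\prod_(j < n) ((a j)%:P + (v j * a j) *: 'X) ^+ e j)`_1 =
  \prod_(j < n) a j ^+ e j * \sum_(j < n) (e j)%:R * v j.
Proof.
apply: coef01_prod => j.
have -> : ((a j)%:P + (v j * a j) *: 'X) ^+ e j =
    \prod_(i < e j) ((a j)%:P + (v j * a j) *: 'X).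
  by rewrite prodr_const card_ord.
split.
  by rewrite -horner_coef0 horner_prod !hornerE ?mulr0 ?addr0 prodr_const card_ord.
rewrite (coef01_prod _ (x := fun=> a j) (c := fun=> v j)).
  by rewrite prodr_const sumr_const card_ord mulr_natl.
by move=> _; rewrite !coefD !coefZ !coefC !coefX /= mulr0 mulr1 addr0 add0r mulrC.
Qed.

Lemma lev_line n (p : zzpoly n R) (a : 'I_n -> R[i]) (v : 'I_n -> R[i]) :
  lev (line p a (fun j => v j * a j)) = \sum_(m <- msupp p) mcoeff m p *
    (\sum_(j < n) (hol_exp m j)%:R * v j) *
    (\sum_(j < n) (anti_exp m j)%:R * Num.conj (v j)) *
    (\prod_(j < n) a j ^+ hol_exp m j * \prod_(j < n) Num.conj (a j) ^+ anti_exp m j).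
Proof.
rewrite /lev big_map; apply: eq_bigr => m _ /=.
rewrite coefZ coef1_exp_line.
under [in X in X`_1]eq_bigr do rewrite rmorphM /=.
by rewrite coef1_exp_line; ring.
Qed.

Lemma conj_prim_root N (w : R[i]) : N.-primitive_root w -> Num.conj w = w^-1.
Proof.
move=> pw; have N0 := prim_order_gt0 pw.
have w1 : `|w| = 1.
  have /eqP := congr1 Num.norm (prim_expr_order pw).
  by rewrite normrX normr1 pexpr_eq1 // => /eqP.
by rewrite invC_norm w1 expr1n invr1 mul1r.
Qed.

Lemma msupp_hol_inj n (p : zzpoly n R) (d : 'I_n -> nat) :
  (forall j, homogeneous_in p j (2 * d j)) ->
  forall m m', m \in msupp p -> m' \in msupp p ->
  (forall j, hol_exp m j = hol_exp m' j) -> m = m'.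
Proof.
move=> hd m m' mp m'p h; apply/mnmP => k; rewrite -[k]splitK.
case: (fintype.split k) => j /=; first exact: h.
have := hd j _ mp; rewrite -(hd j _ m'p) h => /addnI; exact.
Qed.

(** Nonnegativity of the Levi form in the direction [v a], with
    [v = d_j e_i - d_i e_j], at the points [a] of coordinates [w^(k K^x)]. *)
Lemma hol_exp_parallel n (P : 'rV[CC R]_n -> R) (p : zzpoly n R) (d : 'I_n -> nat) :
  is_real_poly P p -> plurisubharmonic P ->
  (forall j, homogeneous_in p j (2 * d j)) ->
  forall m i j, m \in msupp p -> (hol_exp m i * d j = hol_exp m j * d i)%N.
Proof.
move=> hP hpsh hd m0 i j m0p.
have [->//|ij] := eqVneq i j.
pose v x : R[i] := (x == i)%:R * (d j)%:R - (x == j)%:R * (d i)%:R.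
have conjv x : Num.conj (v x) = v x.
  by rewrite /v rmorphB !rmorphM /= !rmorph_nat.
have sumv (e : 'I_n -> nat) : \sum_x (e x)%:R * v x = (e i * d j)%:R - (e j * d i)%:R.
  under eq_bigr do rewrite mulrBr.
  rewrite sumrB; congr (_ - _).
    rewrite (bigD1 i) //= eqxx mul1r big1 ?addr0 ?natrM // => x /negbTE->.
    by rewrite mul0r mulr0.
  rewrite (bigD1 j) //= eqxx mul1r big1 ?addr0 ?natrM // => x /negbTE->.
  by rewrite mul0r mulr0.
pose delta (m : multinom (n + n)) : R[i] := (hol_exp m i * d j)%:R - (hol_exp m j * d i)%:R.
pose K := (2 * \sum_x d x).+1.
pose A (e : 'I_n -> nat) := (\sum_x e x * K ^ x)%N.
have A2 m : m \in msupp p -> (A (hol_exp m) + A (anti_exp m) = 2 * A d)%N.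
  move=> mp; rewrite /A -big_split /= big_distrr /=; apply: eq_bigr => x _.
  by rewrite -mulnDl (hd x _ mp) mulnA.
have dK x : (2 * d x < K)%N by rewrite ltnS leq_mul2l (bigD1 x) //= leq_addr.
have holK m x : m \in msupp p -> (hol_exp m x < K)%N.
  by move=> mp; rewrite (leq_ltn_trans _ (dK x)) // -(hd x _ mp) leq_addr.
pose N := (4 * A d).+1.
have [w pw] := @prim_root_exists R[i] N isT.
have w0 : w != 0 by rewrite (prim_root_eq0 pw).
(* The monomial [m] has frequency [A alpha - A beta = 2 A alpha - 2 A d] at the
   points [a]; [N] exceeds the frequencies [2 A alpha <= 4 A d], which are thus
   distinct modulo [N]. *)
have g0 : forall m, m \in msupp p -> mcoeff m p * delta m * - delta m = 0.
  apply: (fourier_ge0_eq0 (x := fun m => (2 * A (hol_exp m))%N)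
    (y := (2 * A d)%N) pw).
  - exact: msupp_uniq.
  - by move=> m mp; have := A2 m mp; rewrite /N; lia.
  - by rewrite /N; lia.
  - move=> m m' mp m'p /eqP; rewrite eqn_pmul2l // => /eqP E.
    apply: (msupp_hol_inj hd) => // x.
    by apply: (expansion_inj _ _ E) => y; exact: holK.
  - move=> m mp /eqP; rewrite eqn_pmul2l // => /eqP E.
    have md : hol_exp m =1 d.
      apply: (expansion_inj _ _ E) => y; first exact: holK.
      by rewrite (leq_ltn_trans _ (dK y)) // leq_pmull.
    by rewrite /delta !md mulnC subrr mulr0 mul0r.
  - move=> k.
    pose a : 'rV[CC R]_n := \row_x (w ^+ k) ^+ (K ^ x).
    pose b : 'rV[CC R]_n := \row_x (v x * a 0 x).
    have := psh_lev_ge0 a b hP hpsh.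
    have -> : lev (line p (a 0) (b 0)) = lev (line p (a 0) (fun x => v x * a 0 x)).
      by congr (lev (line p _ _)); apply/funext => x; rewrite mxE.
    rewrite lev_line.
    congr (_ <= _); rewrite !big_seq; apply: eq_bigr => m mp.
    rewrite sumv.
    under [in X in _ * X * _]eq_bigr do rewrite conjv.
    rewrite sumv -/(delta m).
    have -> : (anti_exp m i * d j)%:R - (anti_exp m j * d i)%:R = - delta m :> R[i].
      apply/eqP; rewrite -addr_eq0 /delta addrACA -opprD -!natrD -!mulnDl.
      by rewrite ![(anti_exp _ _ + _)%N]addnC !(hd _ _ mp) mulnAC subrr.
    congr (_ * _).
    have prodA (e : 'I_n -> nat) : \prod_x a 0 x ^+ e x = (w ^+ A e) ^+ k.
      rewrite exprAC expr_sum; apply: eq_bigr => x _.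
      by rewrite mxE mulnC [RHS]exprM.
    under [X in _ * X = _]eq_bigr do rewrite -rmorphXn.
    rewrite -rmorph_prod /= !prodA !rmorphXn /= (conj_prim_root pw) exprVn -exprMn.
    congr (_ ^+ k).
    by rewrite -(A2 m mp) mul2n -addnn !exprD invfM mulrA mulfK ?expf_neq0.
have := g0 _ m0p; rewrite mulrN => /eqP.
rewrite oppr_eq0 !mulf_eq0 mcoeff_eq0 m0p /= orbb subr_eq0 eqr_nat => /eqP; exact.
Qed.

End Structure.

(** * Construction of s *)

(** The monomial [z^k conj(z)^l] in one variable. *)
Definition mono (k l : nat) : multinom (1 + 1) :=
  Multinom (mktuple (fun x : 'I_(1 + 1) =>
    match fintype.split x with inl _ => k | inr _ => l end)).

Lemma hol_exp_mono k l j : hol_exp (mono k l) j = k.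
Proof. by rewrite /hol_exp mnmE -[lshift 1 j]/(unsplit (inl j)) unsplitK. Qed.

Lemma anti_exp_mono k l j : anti_exp (mono k l) j = l.
Proof. by rewrite /anti_exp mnmE -[rshift 1 j]/(unsplit (inr j)) unsplitK. Qed.

Lemma mdeg_mono k l : mdeg (mono k l) = (k + l)%N.
Proof.
rewrite mdegE big_split_ord !big_ord1 /=; congr (_ + _)%N.
  exact: (hol_exp_mono k l 0).
exact: (anti_exp_mono k l 0).
Qed.

(** An integer vector [a] parallel to [d] is an integer multiple of [d] divided
    by its gcd. *)
Lemma parallel_gcd n (a d : 'I_n -> nat) (i0 : 'I_n) :
  (forall j, (0 < d j)%N) -> (forall i j, (a i * d j = a j * d i)%N) ->
  let g := \big[gcdn/0%N]_(i < n) d i in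
  forall j, (a j = a i0 %/ (d i0 %/ g) * (d j %/ g))%N.
Proof.
move=> d0 H g j.
have gd i : (g %| d i)%N by apply: biggcdn_inf (dvdnn _).
have g0 : (0 < g)%N by rewrite (dvdn_gt0 _ (gd i0)).
have e0 : (0 < d i0 %/ g)%N by rewrite divn_gt0 // dvdn_leq.
have E : (d i0 %/ g %| a i0)%N.
  rewrite -(dvdn_pmul2r g0) divnK //.
  rewrite /g (big_morph (muln (a i0)) (muln_gcdr _) (muln0 _)).
  by apply/dvdn_biggcdP => i _; rewrite H dvdn_mull.
apply/eqP; rewrite -(eqn_pmul2r e0) -(eqn_pmul2r g0) -[X in X == _]mulnA divnK //.
by rewrite (H j i0) mulnAC -(mulnA _ _ g) divnK // mulnAC divnK.
Qed.

Section Final.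
Variables (R : realType) (n : nat) (P : 'rV[CC R]_n -> R) (p : zzpoly n R).
Variables (d : 'I_n -> nat) (i0 : 'I_n).
Hypotheses (hP : is_real_poly P p) (hpsh : plurisubharmonic P).
Hypotheses (hpl : no_pluriharmonic_terms p) (hd : forall j, (0 < d j)%N).
Hypothesis hdj : forall j, homogeneous_in p j (2 * d j).

(** The monomial [m] of [p] gives the monomial [z^(k m) conj(z)^(l m)] of [s];
    the vector [e] is [d] divided by the gcd [g] of its entries. *)
Let g := \big[gcdn/0%N]_(i < n) d i.
Let e j := (d j %/ g)%N.
Let k m := (hol_exp m i0 %/ e i0)%N.
Let l m := (2 * g - k m)%N.

Let gd j : (g %| d j)%N. Proof. exact: biggcdn_inf (dvdnn _). Qed.
Let g0 : (0 < g)%N. Proof. by rewrite (dvdn_gt0 _ (gd i0)). Qed.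
Let e0 j : (0 < e j)%N. Proof. by rewrite divn_gt0 // dvdn_leq. Qed.

Let holE m j : m \in msupp p -> hol_exp m j = (k m * e j)%N.
Proof.
move=> mp; apply: parallel_gcd => // i j'.
exact: (hol_exp_parallel hP hpsh hdj).
Qed.

Let kle m : m \in msupp p -> (k m <= 2 * g)%N.
Proof.
move=> mp; rewrite -(leq_pmul2r (e0 i0)) -holE // -mulnA [(g * _)%N]mulnC divnK //.
by rewrite -(hdj _ mp) leq_addr.
Qed.

Let antiE m j : m \in msupp p -> anti_exp m j = (l m * e j)%N.
Proof.
move=> mp; apply/(@addnI (hol_exp m j)); rewrite (hdj _ mp) holE // -mulnDl.
by rewrite subnKC ?kle // -mulnA [(g * _)%N]mulnC divnK.
Qed.

Let k0 m : m \in msupp p -> (0 < k m)%N.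
Proof.
move=> mp; have [+ _] := hpl mp; rewrite !lt0n; apply: contra => /eqP km.
by rewrite big1 // => j _; rewrite holE // km.
Qed.

Let l0 m : m \in msupp p -> (0 < l m)%N.
Proof.
move=> mp; have [_ +] := hpl mp; rewrite !lt0n; apply: contra => /eqP km.
by rewrite big1 // => j _; rewrite antiE // km.
Qed.

(** The polynomial [s z = sum_m c_m z^k conj(z)^(2 g - k)], as a sum of products
    [F(z) G(conj z)]. *)
Definition sPairs : zpairs R :=
  [seq (mcoeff m p *: 'X^(k m) : {poly R[i]}, 'X^(l m) : {poly R[i]}) | m <- msupp p].

(** The same polynomial, as a polynomial in two indeterminates. *)
Definition sPoly : zzpoly 1 R :=
  \sum_(m <- msupp p) mcoeff m p *: mpolyX R[i] (mono (k m) (l m)).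

Lemma bevalE z : beval sPairs z =
  \sum_(m <- msupp p) mcoeff m p * (z ^+ k m * Num.conj z ^+ l m).
Proof.
rewrite /beval big_map; apply: eq_bigr => m _ /=.
by rewrite hornerZ !hornerXn mulrA.
Qed.

Lemma zzeval_sPoly (z : 'rV[CC R]_1) : zzeval sPoly z = beval sPairs (z 0 0).
Proof.
rewrite bevalE /zzeval raddf_sum; apply: eq_bigr => m _ /=.
rewrite mevalZ mevalX big_split_ord !big_ord1 /=; congr (_ * (_ * _)).
  by rewrite -[lshift 1 0]/(unsplit (inl 0)) unsplitK; congr (_ ^+ _);
    exact: (hol_exp_mono _ _ 0).
by rewrite -[rshift 1 0]/(unsplit (inr 0)) unsplitK; congr (_ ^+ _);
  exact: (anti_exp_mono _ _ 0).
Qed.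

Lemma beval_prod (z : 'rV[CC R]_n) : zzeval p z = beval sPairs (\prod_j z 0 j ^+ e j).
Proof.
rewrite zzevalE bevalE !big_seq; apply: eq_bigr => m mp.
rewrite rmorph_prod -!prodrXl; congr (_ * (_ * _));
  apply: eq_big => j; rewrite ?mem_index_enum //= => _.
  by rewrite holE // mulnC exprM.
by rewrite antiE // mulnC exprM rmorphXn.
Qed.

Lemma prod_pick (T : comNzRingType) (w : T) (f : 'I_n -> nat) :
  \prod_j (if j == i0 then w else 1) ^+ f j = w ^+ f i0.
Proof.
rewrite (bigD1 i0) //= eqxx big1 ?mulr1 // => j /negbTE ->; exact: expr1n.
Qed.

Lemma root_of (z : R[i]) : exists w, w ^+ e i0 = z.
Proof. by exists ((e i0).-root z); rewrite rootCK. Qed.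

Lemma s_real z : (complex.Re (beval sPairs z))%:C%C = beval sPairs z.
Proof.
have [w <-] := root_of z.
have := beval_prod (\row_j (if j == i0 then w else 1)).
under eq_bigr do rewrite mxE.
by rewrite prod_pick -hP => <-.
Qed.

Lemma s_homogeneous : homogeneous sPoly.
Proof.
exists (2 * g)%N; rewrite /sPoly big_seq rpred_sum // => m mp.
rewrite rpredZ // dhomogX; apply/eqP.
by rewrite -[RHS](subnKC (kle mp)); exact: mdeg_mono.
Qed.

Lemma s_no_harmonic : no_pluriharmonic_terms sPoly.
Proof.
move=> m'; rewrite mcoeff_msupp => H.
have [m mp ->] : exists2 m, m \in msupp p & m' = mono (k m) (l m).
  have [/hasP[m mp /eqP E]|/hasPn hn] := boolP (has (fun m =>
      m' == mono (k m) (l m)) (msupp p)).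
    by exists m.
  case/eqP: H; rewrite /sPoly raddf_sum big1_seq // => m /andP[_ mp] /=.
  by rewrite mcoeffZ mcoeffX eq_sym (negbTE (hn m mp)) mulr0.
by rewrite !big_ord1 hol_exp_mono anti_exp_mono k0 ?l0.
Qed.

Lemma lap_sE z : beval (lap sPairs) z =
  \sum_(m <- msupp p) mcoeff m p * ((k m)%:R * (l m)%:R) *
    (z ^+ (k m).-1 * Num.conj z ^+ (l m).-1).
Proof.
rewrite /beval 2!big_map; apply: eq_bigr => m _ /=.
rewrite derivZ !derivXn hornerZ !hornerMn !hornerXn.
by rewrite -[X in _ * X * _]mulr_natl -[X in _ * X = _]mulr_natl; ring.
Qed.

(** At a point [a] with coordinates [1] except [a_i0 = w], where
    [w^(e i0) = z], the Levi form of [P] in the direction [i0] is a positive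
    multiple [c] of the Laplacian of [s] at [z]. *)
Lemma lap_s_ge0_neq0 z : z != 0 -> 0 <= beval (lap sPairs) z.
Proof.
move=> z0; have [w wz] := root_of z.
have w0 : w != 0 by apply: contra z0 => /eqP w0; rewrite -wz w0 expr0n gtn_eqF.
pose a : 'rV[CC R]_n := \row_j (if j == i0 then w else 1).
pose v j : R[i] := if j == i0 then w^-1 else 0.
pose b : 'rV[CC R]_n := \row_j (v j * a 0 j).
have := psh_lev_ge0 a b hP hpsh.
have -> : lev (line p (a 0) (b 0)) = lev (line p (a 0) (fun x => v x * a 0 x)).
  by congr (lev (line p _ _)); apply/funext => x; rewrite mxE.
rewrite lev_line.
have sumv (f : 'I_n -> nat) (c : R[i]) :
    \sum_j (f j)%:R * (if j == i0 then c else 0) = (f i0)%:R * c.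
  by rewrite (bigD1 i0) //= eqxx big1 ?addr0 // => j /negbTE ->; rewrite mulr0.
have conjv j : Num.conj (v j) = if j == i0 then Num.conj w^-1 else 0.
  by rewrite /v; case: eqP => // _; rewrite rmorph0.
have conja j : Num.conj (a 0 j : R[i]) = if j == i0 then Num.conj w else 1.
  by rewrite mxE; case: eqP => // _; rewrite rmorph1.
pose c : R[i] := ((e i0)%:R ^+ 2 * (w^-1 * Num.conj w^-1)) * (z * Num.conj z).
have c0 : 0 < c.
  apply: mulr_gt0; [apply: mulr_gt0|]; rewrite ?mul_conjC_gt0 ?invr_eq0 //.
  by rewrite exprn_gt0 ?ltr0n.
suff -> : \sum_(m <- msupp p) mcoeff m p *
    (\sum_j (hol_exp m j)%:R * v j) *
    (\sum_j (anti_exp m j)%:R * Num.conj (v j)) *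
    (\prod_j a 0 j ^+ hol_exp m j * \prod_j Num.conj (a 0 j : R[i]) ^+ anti_exp m j) =
    c * beval (lap sPairs) z by rewrite pmulr_rge0.
rewrite lap_sE mulr_sumr !big_seq; apply: eq_bigr => m mp.
rewrite sumv; under [X in _ * X * _ = _]eq_bigr do rewrite conjv.
rewrite sumv; under [X in _ * (X * _) = _]eq_bigr do rewrite mxE.
under [X in _ * (_ * X) = _]eq_bigr do rewrite conja.
rewrite !prod_pick holE // antiE // mulnC exprM wz.
rewrite mulnC [(l m * _)%N]mulnC exprM -rmorphXn /= wz [(_ * l m)%N]mulnC.
rewrite -{2}(prednK (k0 mp)) -{2}(prednK (l0 mp)) !exprS !natrM /c.
ring.
Qed.

(** The Laplacian of [s] is homogeneous of degree [2 g - 2]: at [0] it is zero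
    if [g <> 1], and it is constant if [g = 1]. *)
Lemma lap_s_ge0 z : 0 <= beval (lap sPairs) z.
Proof.
have [->|] := eqVneq z 0; last exact: lap_s_ge0_neq0.
have kl m : m \in msupp p -> (k m + l m = 2 * g)%N by move=> mp; rewrite subnKC ?kle.
have [g1|g1] := eqVneq g 1%N.
  have lapE y : beval (lap sPairs) y = \sum_(m <- msupp p) mcoeff m p.
    rewrite lap_sE !big_seq; apply: eq_bigr => m mp.
    have km : k m = 1%N.
      have := kl m mp; have := k0 mp; have := l0 mp; rewrite g1.
      by move: (k m) (l m) => u v; clear; lia.
    have lm : l m = 1%N by have := kl m mp; rewrite g1 km => -[].
    by rewrite km lm !expr0 !mulr1.
  by rewrite lapE -(lapE 1) lap_s_ge0_neq0 // oner_neq0.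
rewrite lap_sE big1_seq // => m /andP[_ mp].
rewrite rmorph0 !expr0n.
have [km|km] := eqVneq (k m).-1 0%N; last by rewrite mul0r mulr0.
have [lm|lm] := eqVneq (l m).-1 0%N; last by rewrite !mulr0.
case/eqP: g1; apply/eqP; rewrite -(eqn_pmul2l (isT : (0 < 2)%N)) -(kl m mp).
by rewrite -(prednK (k0 mp)) -(prednK (l0 mp)) km lm.
Qed.

Lemma s_subharmonic : subharmonic (fun z : CC R => complex.Re (beval sPairs z)).
Proof.
apply: subharmonic_beval => z.
by have := lap_s_ge0 z; rewrite lecE => /andP[].
Qed.

End Final.

Theorem corollary2p5 (R : realType) (n : nat) (hn : (2 <= n)%N)
    (P : 'rV[CC R]_n -> R) (p : zzpoly n R) (d : 'I_n -> nat)
    (hP : is_real_poly P p)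
    (hnc : ~ exists c : R, forall z, P z = c)
    (hhom : homogeneous p)
    (hpsh : plurisubharmonic P)
    (hpl : no_pluriharmonic_terms p)
    (hd : forall j, (0 < d j)%N)
    (hdj : forall j, homogeneous_in p j (2 * d j)) :
  exists (s : CC R -> R) (q : zzpoly 1 R),
    [/\ is_real_poly (fun z : 'rV[CC R]_1 => s (z 0 0)) q,
        homogeneous q,
        subharmonic s,
        no_pluriharmonic_terms q
      & forall z : 'rV[CC R]_n,
          P z = s (\prod_(j < n) z 0 j ^+ (d j %/ \big[gcdn/0%N]_(i < n) d i)%N)].
Proof.
have i0 : 'I_n by apply: (Ordinal (n := n) (m := 0)); exact: ltn_trans hn.
exists (fun z => complex.Re (beval (sPairs p d i0) z)), (sPoly p d i0); split.
- by move=> z; rewrite zzeval_sPoly; exact: s_real hP hpsh hd hdj _.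
- exact: s_homogeneous hP hpsh hd hdj.
- exact: s_subharmonic hP hpsh hpl hd hdj.
- exact: s_no_harmonic hP hpsh hpl hd hdj.
- by move=> z; rewrite -(beval_prod i0 hP hpsh hd hdj) -hP.
Qed.
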